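(* For every integer $n\ge 7$, let $(\beta_S-\beta_M)(n)$ denote the maximum of $\beta_S(G)-\beta_M(G)$ over all connected graphs $G$ of order $n$. Then $$\left\lfloor \tfrac{n-1}{2}\right\rfloor-2\le (\beta_S-\beta_M)(n)\le n-4.$$
   Context: All graphs are simple, undirected, finite and connected; $d(u,v)$ is the shortest-path distance between vertices $u,v$. For an edge $uv$ and a vertex $w$, $d(uv,w)=\min\{d(u,w),d(v,w)\}$. A vertex $w$ resolves two items $a,b$ (vertices or edges) if $d(a,w)\neq d(b,w)$. A vertex set $S\subseteq V(G)$ is a mixed resolving set if every two distinct elements of $V(G)\cup E(G)$ are resolved by some vertex of $S$; the mixed metric dimension $\beta_M(G)$ is the minimum cardinality of a mixed resolving set. A vertex $w$ strongly resolves vertices $u,v$ if $u$ lies on some shortest $v$–$w$ path or $v$ lies on some shortest $u$–$w$ path. $S\subseteq V(G)$ is a strong resolving set if every two distinct vertices of $V(G)\setminus S$ are strongly resolved by some vertex of $S$; the strong metric dimension $\beta_S(G)$ is the minimum cardinality of a strong resolving set. *)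

(* Defs.v *)
From HB Require Import structures.
From mathcomp Require Import all_boot all_order all_algebra.

Set Implicit Arguments.
Unset Strict Implicit.
Unset Printing Implicit Defensive.

Import Order.TTheory GRing.Theory Num.Theory.

Record cgraph := CGraph {
  vertex :> finType;
  adj : rel vertex;
  adj_sym : symmetric adj;
  adj_irr : irreflexive adj;
  adj_connected : forall u v : vertex, connect adj u v
}.

Section MetricDimensions.

Variable G : cgraph.
Implicit Types (u v w x : G) (S : {set G}).

(* A k.-tuple p encodes the walk u :: p, which has k edges. *)
Definition is_walk u v k (p : k.-tuple G) : bool :=
  path (@adj G) u p && (last u p == v).

Lemma ex_walk u v : exists k, [exists p : k.-tuple G, is_walk u v p].
Proof.
have /connectP[p pth ->] := adj_connected u v.
by exists (size p); apply/existsP; exists (in_tuple p); rewrite /is_walk pth /=.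
Qed.

Definition dist u v : nat := ex_minn (ex_walk u v).

Definition edist u v w : nat := minn (dist u w) (dist v w).

(* Two edges uv and u'v' are equal when their sets of ends are; a vertex and
   an edge are always distinct elements of V(G) U E(G). *)
Definition mixed_resolving S : bool :=
  [&& [forall x, forall y, (x != y) ==>
         [exists w in S, dist x w != dist y w]],
      [forall x, forall u, forall v, adj u v ==>
         [exists w in S, dist x w != edist u v w]]
    & [forall u, forall v, forall u', forall v',
         [&& adj u v, adj u' v' & [set u; v] != [set u'; v']] ==>
         [exists w in S, edist u v w != edist u' v' w]]].

Definition on_shortest_path x u v : bool :=
  [exists p : (dist u v).-tuple G, is_walk u v p && (x \in u :: p)].

Definition strongly_resolves w u v : bool :=
  on_shortest_path u v w || on_shortest_path v u w.

Definition strong_resolving S : bool :=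
  [forall u, forall v, [&& u \notin S, v \notin S & u != v] ==>
     [exists w in S, strongly_resolves w u v]].

(* Minimum of #|S| over the S satisfying P, provided P holds of the full set;
   mixed_resolvingT and strong_resolvingT discharge this proviso. *)
Definition min_card (P : pred {set G}) : nat :=
  #|[arg min_(S < [set: G] | P S) #|S|]|.

Definition beta_M : nat := min_card mixed_resolving.
Definition beta_S : nat := min_card strong_resolving.

Lemma dist_eq0 u v : (dist u v == 0) = (u == v).
Proof.
rewrite /dist; case: ex_minnP => k /existsP[p /andP[_ pl]] kmin.
apply/eqP/eqP => [k0|uv].
  by move: p pl; rewrite k0 => p; rewrite tuple0 /= => /eqP.
apply/eqP; rewrite -leqn0; apply: kmin; apply/existsP; exists [tuple].
by rewrite /is_walk /= uv.
Qed.

Lemma mixed_resolvingT : mixed_resolving [set: G].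
Proof.
have d0 x : dist x x = 0 by apply/eqP; rewrite dist_eq0.
have ed0 u v w : (edist u v w == 0) = (w \in [set u; v]).
  rewrite /edist -leqn0 geq_min !leqn0 !dist_eq0 !inE.
  by rewrite (eq_sym u) (eq_sym v).
have neq0 m n : (m == 0) != (n == 0) -> m != n.
  by apply: contra => /eqP->.
apply/and3P; split.
- apply/forallP=> x; apply/forallP=> y; apply/implyP=> xy.
  apply/existsP; exists x; rewrite inE /=; apply: neq0.
  by rewrite !dist_eq0 eqxx (eq_sym y) (negPf xy).
- apply/forallP=> x; apply/forallP=> u; apply/forallP=> v; apply/implyP=> uv.
  have nuv : u != v by apply: contraTneq uv => ->; rewrite adj_irr.
  have [xu|xu] := eqVneq x u; apply/existsP.
    exists v; rewrite inE /=; apply: neq0.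
    by rewrite ed0 dist_eq0 !inE eqxx orbT xu (negPf nuv).
  exists u; rewrite inE /=; apply: neq0.
  by rewrite ed0 dist_eq0 !inE eqxx (negPf xu).
- apply/forallP=> u; apply/forallP=> v; apply/forallP=> u'; apply/forallP=> v'.
  apply/implyP=> /and3P[_ _]; apply: contraR => /existsPn H.
  apply/eqP/setP=> w; rewrite -!ed0.
  by move: (H w); rewrite inE /= negbK => /eqP ->.
Qed.

Lemma strong_resolvingT : strong_resolving [set: G].
Proof. by apply/forallP=> u; apply/forallP=> v; rewrite inE. Qed.

Definition beta_diff : int := (beta_S%:Z - beta_M%:Z)%R.

End MetricDimensions.

Definition is_max_beta_diff (n : nat) (m : int) : Prop :=
  (exists G : cgraph, #|G| = n /\ beta_diff G = m) /\
  (forall G : cgraph, #|G| = n -> (beta_diff G <= m)%R).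

(* Main.v *)
Require Import Defs.
From mathcomp Require Import all_boot all_order all_algebra.
From mathcomp Require Import zify.
From Stdlib Require Import Classical_Prop.

Set Implicit Arguments.
Unset Strict Implicit.
Unset Printing Implicit Defensive.

(** Upper bound: a mixed resolving set has at least two vertices, since [w] and
    an edge at [w] are both at distance [0] from [w].  A non-complete graph has
    a strong resolving set missing two vertices, namely the first two vertices
    of a geodesic of length at least two, which its last vertex strongly
    resolves.  In a complete graph every mixed resolving set is the whole vertex
    set.

    Lower bound: the cycle of order [n].  A strong resolving set meets every
    pair of vertices at distance [n./2], so it has at least half of the
    vertices, and the three vertices [0], [1], [n./2 + 1] resolve all vertices
    and edges. *)

(** * Geodesics and the upper bound in an arbitrary connected graph *)

Section Distance.

Variable G : cgraph.
Implicit Types (u v w x : G) (S : {set G}) (p : seq G).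

Lemma dist_le_size u v p :
  path (@adj G) u p -> last u p = v -> dist u v <= size p.
Proof.
move=> pth lst; rewrite /dist; case: ex_minnP => k _; apply.
by apply/existsP; exists (in_tuple p); rewrite /is_walk pth lst /=.
Qed.

Lemma dist_geodesic u v :
  exists p, [/\ path (@adj G) u p, last u p = v & size p = dist u v].
Proof.
rewrite /dist; case: ex_minnP => k /existsP[p /andP[pth /eqP lst]] _.
by exists p; rewrite size_tuple.
Qed.

Lemma distxx u : dist u u = 0.
Proof. by apply/eqP; rewrite dist_eq0. Qed.

Lemma dist_adj u v : adj u v -> dist u v = 1.
Proof.
move=> uv; apply/eqP; rewrite eqn_leq (@dist_le_size u v [:: v]) /= ?uv //.
by rewrite lt0n dist_eq0; apply: contraTneq uv => ->; rewrite adj_irr.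
Qed.

Lemma geodesic_on_shortest_path x u v p :
  path (@adj G) u p -> last u p = v -> size p = dist u v -> x \in u :: p ->
  on_shortest_path x u v.
Proof.
move=> pth lst /eqP sz xp; apply/existsP; exists (Tuple sz).
by rewrite /is_walk /= pth lst eqxx.
Qed.

(** Cutting the geodesic at [x] gives walks bounding the two distances. *)
Lemma on_shortest_path_dist x u v :
  on_shortest_path x u v -> dist u x + dist x v <= dist u v.
Proof.
move=> /existsP[p /andP[/andP[pth /eqP lst] xp]].
rewrite -[X in _ <= X](size_tuple p).
case/splitPl: {p}(tval p) / xp pth lst => p1 p2 lst1.
rewrite cat_path last_cat lst1 size_cat => /andP[pth1 pth2] lst2.
by rewrite leq_add // dist_le_size.
Qed.

Lemma exists_adj w : 1 < #|G| -> exists u, adj w u.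
Proof.
move=> /card_gt1P[x [y [_ _ xy]]].
have [v vw] : exists v, v != w.
  by have [<-|xw] := eqVneq x w; [exists y; rewrite eq_sym | exists x].
have /connectP[[|u p] /=] := adj_connected w v.
  by move=> _ vE; rewrite vE eqxx in vw.
by move=> /andP[wu _] _; exists u.
Qed.

Lemma min_card_le (P : pred {set G}) S :
  P [set: G] -> P S -> min_card P <= #|S|.
Proof.
by move=> PT PS; rewrite /min_card; case: arg_minnP => // T _; apply.
Qed.

Lemma min_card_ge (P : pred {set G}) k :
  P [set: G] -> (forall S, P S -> k <= #|S|) -> k <= min_card P.
Proof.
by move=> PT Pk; rewrite /min_card; case: arg_minnP => // T PT' _; apply: Pk.
Qed.

Lemma beta_M_ge2 : 1 < #|G| -> 1 < beta_M G.
Proof.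
move=> G_gt1; apply: min_card_ge; first exact: mixed_resolvingT.
move=> S /and3P[_ /forallP resVE _]; rewrite ltnNge; apply/negP => S_le1.
have [w Sw] : exists w, {subset S <= [set w]}.
  have [S0|[w wS]] := set_0Vmem S.
    have /card_gt0P[x _] : 0 < #|G| by exact: ltnW.
    by exists x => y; rewrite S0 in_set0.
  by exists w => y yS; rewrite inE; apply/eqP; exact: (card_le1_eqP S_le1).
have [u wu] := exists_adj w G_gt1.
have /forallP/(_ w)/forallP/(_ u) := resVE w.
rewrite wu => /existsP[x /andP[/Sw]]; rewrite inE => /eqP->.
by rewrite /edist distxx min0n.
Qed.

(** Only [x] resolves [y] from the edge [xy]: any other vertex is at distance 0 from both if it is
    [y], and at distance 1 from both otherwise. *)
Lemma beta_M_complete :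
  (forall u v, u != v -> adj u v) -> 1 < #|G| -> #|G| <= beta_M G.
Proof.
move=> Gc G_gt1; apply: min_card_ge; first exact: mixed_resolvingT.
move=> S /and3P[_ /forallP resVE _].
suff -> : S = setT by rewrite cardsT.
apply/setP => x; rewrite inE; apply/negP => /negP xS.
have [y xy] := exists_adj x G_gt1.
have /forallP/(_ x)/forallP/(_ y) := resVE y.
rewrite xy => /existsP[w /andP[wS]].
have xw : x != w by apply: contraNneq xS => ->.
rewrite /edist (dist_adj (Gc _ _ xw)).
have [->|/Gc/dist_adj->] := eqVneq y w; first by rewrite distxx.
by rewrite eqxx.
Qed.

Lemma beta_S_le_pred : 0 < #|G| -> beta_S G <= #|G|.-1.
Proof.
move=> /card_gt0P[x _]; rewrite -(cardsC1 x).
apply: min_card_le; first exact: strong_resolvingT.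
apply/forallP => u; apply/forallP => v; apply/implyP.
rewrite !inE !negbK => /and3P[/eqP-> /eqP->]; by rewrite eqxx.
Qed.

Lemma beta_S_noncomplete u v : u != v -> ~~ adj u v -> beta_S G <= #|G|.-2.
Proof.
move=> uv nuv; have [[|w p] [pth lst sz]] := dist_geodesic u v.
  by rewrite -lst eqxx in uv.
have /= /andP[uw _] := pth.
have nuw : u != w by apply: contraTneq uw => ->; rewrite adj_irr.
(* Non-adjacency keeps [v] outside the omitted pair [u], [w], so [v] may serve as the resolving
   vertex. *)
have nvw : v != w by apply: contraNneq nuv => ->.
have res : on_shortest_path w u v.
  by apply: geodesic_on_shortest_path pth lst sz _; rewrite !inE eqxx orbT.
have -> : #|G|.-2 = #|~: [set u; w]| by rewrite cardsCs setCK cards2 nuw subn2.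
apply: min_card_le; first exact: strong_resolvingT.
apply/forallP => x; apply/forallP => y; apply/implyP.
rewrite !inE !negbK => /and3P[xuw yuw xy].
apply/existsP; exists v; rewrite !inE (eq_sym v u) (negPf uv) (negPf nvw) /=.
move: xuw yuw xy => /orP[]/eqP-> /orP[]/eqP->; rewrite ?eqxx // => _;
  by rewrite /strongly_resolves res ?orbT.
Qed.

(** The difference is at most -1 for a complete graph, which [2 < #|G|] makes small enough, and at
    most [(#|G| - 2) - 2] otherwise. *)
Lemma beta_diff_le : 2 < #|G| -> (beta_diff G <= #|G|%:Z - 4)%R.
Proof.
move=> G_gt2; have bM := beta_M_ge2 (ltnW G_gt2); rewrite /beta_diff.
case: (boolP [forall u : G, forall v : G, (u != v) ==> adj u v]).
  move=> /forallP Gc.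
  have {}Gc u v : u != v -> adj u v by move: (Gc u) => /forallP/(_ v)/implyP.
  have := beta_M_complete Gc (ltnW G_gt2).
  have := beta_S_le_pred (ltnW (ltnW G_gt2)); lia.
move=> /forallPn[u /forallPn[v]]; rewrite negb_imply => /andP[uv nuv].
have := beta_S_noncomplete uv nuv; lia.
Qed.

End Distance.

(** * The cycle and the lower bound *)

Section Cycle.

Variables (n : nat) (n_ge7 : 7 <= n).
Implicit Types u v w : 'I_n.

Definition cycle_adj : rel 'I_n := fun u v =>
  [|| v == u.+1 :> nat, u == v.+1 :> nat,
      (u == 0 :> nat) && (v == n.-1 :> nat)
    | (v == 0 :> nat) && (u == n.-1 :> nat)].

(** Length of the shorter arc; with truncated subtraction, [(a - b) + (b - a)] is the absolute
    difference. *)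
Definition cycle_dist (a b : nat) : nat :=
  minn ((a - b) + (b - a)) (n - ((a - b) + (b - a))).

Lemma cycle_adj_sym : symmetric cycle_adj.
Proof. by move=> u v; rewrite /cycle_adj; lia. Qed.

Lemma cycle_adj_irr : irreflexive cycle_adj.
Proof. by move=> u; rewrite /cycle_adj; lia. Qed.

Lemma cycle_dist_adj u v w :
  cycle_adj u v -> cycle_dist u w <= (cycle_dist v w).+1.
Proof.
move: (ltn_ord u) (ltn_ord v) (ltn_ord w); rewrite /cycle_adj /cycle_dist; lia.
Qed.

Lemma cycle_step_towards u w :
  u != w -> exists2 v, cycle_adj u v & cycle_dist u w = (cycle_dist v w).+1.
Proof.
rewrite -val_eqE /= => uw; have un := ltn_ord u; have wn := ltn_ord w.
have Hv m : m < n ->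
  [|| m == u.+1, u == m.+1 :> nat, (u == 0 :> nat) && (m == n.-1)
    | (m == 0) && (u == n.-1 :> nat)] ->
  cycle_dist u w = (cycle_dist m w).+1 ->
  exists2 v, cycle_adj u v & cycle_dist u w = (cycle_dist v w).+1.
  by move=> mn ? ?; exists (Ordinal mn).
(* The test holds when increasing labels follow a shortest arc to [w]; the step wraps from [n.-1] to
   0. *)
case: (boolP (((u < w) && (w - u <= n./2)) || ((w < u) && (n./2 < u - w)))) => h.
  have [uS|uS] := ltnP u.+1 n.
    apply: (Hv u.+1) => //; [lia | rewrite /cycle_dist; lia].
  apply: (Hv 0); [lia | lia | rewrite /cycle_dist; lia].
have [u0|u0] := posnP u.
  apply: (Hv n.-1); [lia | lia | rewrite /cycle_dist; lia].
apply: (Hv u.-1); [lia | lia | rewrite /cycle_dist; lia].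
Qed.

Lemma cycle_walk u w :
  exists p, [/\ path cycle_adj u p, last u p = w & size p = cycle_dist u w].
Proof.
move Ek: (cycle_dist u w) => k; elim: k u Ek => [|k IHk] u Ek.
  exists [::]; split=> //=; apply: val_inj => /=.
  move: Ek (ltn_ord u) (ltn_ord w); rewrite /cycle_dist; lia.
have [uw|/cycle_step_towards[v uv]] := eqVneq u w.
  by move: Ek; rewrite uw /cycle_dist; lia.
rewrite Ek => -[Ev]; have [p [pth lst sz]] := IHk v (esym Ev).
by exists (v :: p); rewrite /= uv pth lst sz.
Qed.

Lemma cycle_connected u w : connect cycle_adj u w.
Proof. by have [p [pth <- _]] := cycle_walk u w; apply/connectP; exists p. Qed.

Definition cycle_graph : cgraph :=
  CGraph cycle_adj_sym cycle_adj_irr cycle_connected.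

(** A walk along the shorter arc gives one inequality; the other holds because [cycle_dist] drops by
    at most one per edge. *)
Lemma dist_cycle (u w : cycle_graph) : dist u w = cycle_dist u w.
Proof.
apply/eqP; rewrite eqn_leq; apply/andP; split.
  by have [p [pth lst <-]] := cycle_walk u w; exact: dist_le_size.
have [p [pth lst <-]] := dist_geodesic u w.
elim: p u pth lst => [|v p IHp] u /=.
  by move=> _ ->; rewrite /cycle_dist; lia.
move=> /andP[uv pth] lst.
by apply: leq_trans (cycle_dist_adj w uv) _; rewrite ltnS IHp.
Qed.

Lemma beta_S_cycle_ge : n <= (beta_S cycle_graph).*2.
Proof.
suff : uphalf n <= beta_S cycle_graph by lia.
apply: min_card_ge; first exact: strong_resolvingT.
move=> S /forallP Sres.
have n_gt0 : 0 < n by lia.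
(* Rotation by [n./2]. It is not an involution for odd [n], so the final count uses only its
   injectivity. *)
pose opp (u : cycle_graph) : cycle_graph :=
  Ordinal (ltn_pmod (u + n./2) n_gt0).
have oppE (u : cycle_graph) : opp u < n /\
    (opp u = u + n./2 :> nat \/ opp u + n = u + n./2).
  split; first exact: ltn_ord.
  rewrite /=; case: (ltnP (u + n./2) n) => h; first by left; rewrite modn_small.
  right; rewrite -{1}(subnK h) modnDr modn_small ?subnK //.
  move: (ltn_ord u); lia.
have opp_inj : injective opp.
  move=> u v /(congr1 (@nat_of_ord n)) E; apply: val_inj => /=.
  move: E (oppE u) (oppE v) (ltn_ord u) (ltn_ord v).
  by move: (opp u : nat) (opp v : nat); lia.
(* Since [n./2] is the diameter, no geodesic extends beyond [u] and [opp u]: only these two vertices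
   strongly resolve the pair. *)
have far (u w : cycle_graph) :
    dist u (opp u) + dist u w <= dist (opp u) w -> u = w.
  rewrite !dist_cycle => h; apply: ord_inj; move: h (oppE u).
  move: (opp u : nat) (ltn_ord u) (ltn_ord w); rewrite /cycle_dist /=; lia.
have far' (u w : cycle_graph) :
    dist u (opp u) + dist (opp u) w <= dist u w -> opp u = w.
  rewrite !dist_cycle => h; apply: ord_inj; move: h (oppE u).
  move: (opp u : nat) (ltn_ord u) (ltn_ord w); rewrite /cycle_dist /=; lia.
have distC (u v : cycle_graph) : dist u v = dist v u.
  by rewrite !dist_cycle /cycle_dist; lia.
have meets u : (u \in S) || (opp u \in S).
  apply: contraT; rewrite negb_or => /andP[uS oS].
  have := Sres u => /forallP/(_ (opp u)); rewrite uS oS /=.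
  have -> : u != opp u.
    apply/eqP => /(congr1 (@nat_of_ord n)); move: (oppE u) (ltn_ord u).
    by move: (opp u : nat); lia.
  move=> /existsP[w /andP[wS /orP[]/on_shortest_path_dist]].
    by rewrite distC => /far uw; rewrite uw wS in uS.
  by move=> /far' ow; rewrite ow wS in oS.
have cover : setT \subset S :|: opp @^-1: S.
  by apply/subsetP => u _; rewrite !inE meets.
have := leq_trans (subset_leq_card cover) (leq_card_setU _ _).
rewrite cardsT card_ord => h.
have : #|opp @^-1: S| <= #|S|.
  rewrite -(card_imset _ opp_inj); apply/subset_leq_card/subsetP => y.
  by case/imsetP => x; rewrite inE => xS ->.
lia.
Qed.

(* Subdividing every edge puts the vertices and edges of the cycle at the even
   and odd positions of a cycle of order 2n; the distance of the element at
   position [p] to the vertex [w] is then half the distance from [p] to [2w],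
   rounded down. *)
Definition position_dist (p w : nat) : nat :=
  (minn ((p - w.*2) + (w.*2 - p)) (n.*2 - ((p - w.*2) + (w.*2 - p))))./2.

(** The ranges in [E] are cut where a shorter arc changes side. On the two long ranges the distances
    to 0 and [n./2.+1] round [r./2] in opposite directions up to sign and shift, which fixes [r];
    the distance to 0 minus that to 1 is 1 on the second range, 0 on the third and -1 on the
    fourth. *)
Lemma position_dist_inj p q : p < n.*2 -> q < n.*2 ->
  position_dist p 0 = position_dist q 0 ->
  position_dist p 1 = position_dist q 1 ->
  position_dist p n./2.+1 = position_dist q n./2.+1 -> p = q.
Proof.
have E r : r < n.*2 ->
    [\/ [/\ r < 2, position_dist r 0 = 0, position_dist r 1 = 1 - r
         & position_dist r n./2.+1 = (uphalf n).-1],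
        [/\ 2 <= r <= n, position_dist r 0 = r./2,
            position_dist r 1 = (r - 2)./2
         & position_dist r n./2.+1 = (n./2.*2 + 2 - r)./2],
        [/\ r = n.+1, position_dist r 0 = n.-1./2,
            position_dist r 1 = n.-1./2 & position_dist r n./2.+1 = 0]
      | [/\ n + 2 <= r < n.*2, position_dist r 0 = (n.*2 - r)./2,
            position_dist r 1 = (n.*2 + 2 - r)./2
         & position_dist r n./2.+1 = (r - (n./2.*2 + 2))./2]].
  move=> rn; rewrite /position_dist.
  have [r2|r2] := ltnP r 2; first by apply: Or41; split; lia.
  have [rn'|rn'] := leqP r n; first by apply: Or42; split; lia.
  have [rk|rk] := ltnP r (n + 2); first by apply: Or43; split; lia.
  by apply: Or44; split; lia.
move=> /E Ep /E Eq.
case: Ep => [[? -> -> ->]|[? -> -> ->]|[? -> -> ->]|[? -> -> ->]];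
case: Eq => [[? -> -> ->]|[? -> -> ->]|[? -> -> ->]|[? -> -> ->]]; lia.
Qed.

Lemma dist_position (u w : cycle_graph) : dist u w = position_dist u.*2 w.
Proof. by rewrite dist_cycle /cycle_dist /position_dist; lia. Qed.

(** The last clause recovers the edge from its odd position: [x] is its first end in cyclic order
    and [y] the successor of [x]. *)
Lemma edist_position (u v : cycle_graph) : adj u v -> exists2 p, p < n.*2 &
  (forall w : cycle_graph, edist u v w = position_dist p w) /\
  exists2 x : cycle_graph, p = x.*2.+1 &
    exists2 y : cycle_graph, y = x.+1 %% n :> nat & [set u; v] = [set x; y].
Proof.
(* Orient the edge so that [v] is the cyclic successor of [u]. *)
wlog uv : u v / (v == u.+1 :> nat) || (v == 0 :> nat) && (u == n.-1 :> nat).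
  move=> H; rewrite /= /cycle_adj => uv.
  have [h|h] := boolP ((v == u.+1 :> nat) || (v == 0 :> nat) && (u == n.-1 :> nat)).
    by apply: H.
  have [||p pn [pE xE]] := H v u; [lia | rewrite /= /cycle_adj; lia |].
  exists p => //; split; first by move=> w; rewrite -pE /edist minnC.
  by rewrite setUC.
move=> _; have un := ltn_ord u; have vn := ltn_ord v.
exists u.*2.+1; first lia.
split.
  move=> w; have wn := ltn_ord w.
  rewrite /edist !dist_cycle /cycle_dist /position_dist.
  by case/orP: uv => [/eqP->|/andP[/eqP-> /eqP->]]; case: (leqP w u) => ?; lia.
exists u => //; exists v => //.
case/orP: uv => [/eqP vE|/andP[/eqP-> /eqP->]].
  by rewrite modn_small -vE.
by rewrite prednK ?modnn; lia.
Qed.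

Lemma beta_M_cycle_le : beta_M cycle_graph <= 3.
Proof.
have [n0 n1 nk] : [/\ 0 < n, 1 < n & n./2.+1 < n] by split; lia.
pose S : {set cycle_graph} := [set Ordinal n0; Ordinal n1; Ordinal nk].
have S_le3 : #|S| <= 3.
  by rewrite /S (leq_trans (leq_card_setU _ _)) // cards1 cards2; case: (_ != _).
apply: leq_trans S_le3; apply: min_card_le; first exact: mixed_resolvingT.
(* Elements at distinct positions are resolved by [S], whether they are vertices or edges. *)
have resP p q (f g : cycle_graph -> nat) : p < n.*2 -> q < n.*2 ->
    f =1 position_dist p -> g =1 position_dist q -> p != q ->
    [exists w in S, f w != g w].
  move=> pn qn fE gE; apply: contraR => /existsPn H; apply/eqP.
  have HS w : w \in S -> position_dist p w = position_dist q w.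
    by move=> wS; have := H w; rewrite wS negbK -fE -gE => /eqP.
  apply: position_dist_inj => //.
  - by apply: (HS (Ordinal n0)); rewrite !inE eqxx.
  - by apply: (HS (Ordinal n1)); rewrite !inE eqxx ?orbT.
  - by apply: (HS (Ordinal nk)); rewrite !inE eqxx ?orbT.
have dbl (x : cycle_graph) : x.*2 < n.*2 by rewrite ltn_double ltn_ord.
apply/and3P; split.
- apply/forallP => x; apply/forallP => y; apply/implyP => xy.
  apply: (@resP x.*2 y.*2) => // [w|w|]; try exact: dist_position.
  by rewrite (inj_eq double_inj).
- apply/forallP => x; apply/forallP => u; apply/forallP => v; apply/implyP.
  move=> /edist_position[p pn [pE [y py _]]].
  (* An even position differs from an odd one. *)
  by apply: (@resP x.*2 p) => // [w|]; [exact: dist_position | lia].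
- apply/forallP => u; apply/forallP => v; apply/forallP => u'.
  apply/forallP => v'; apply/implyP => /and3P[uv uv' ne].
  have [p pn [pE [x px [y yE xyE]]]] := edist_position uv.
  have [q qn [qE [x' qx' [y' yE' xyE']]]] := edist_position uv'.
  apply: (@resP p q) => //; apply: contraNneq ne => pq.
  have xx' : x = x' by apply: val_inj => /=; lia.
  have yy' : y = y' by apply: val_inj; rewrite /= yE yE' xx'.
  by rewrite xyE xyE' xx' yy'.
Qed.

(** Half of [n] rounded up is [(n - 1) %/ 2 + 1]; subtracting 3 gives the bound. *)
Lemma beta_diff_cycle_ge :
  (((n - 1) %/ 2)%N%:Z - 2 <= beta_diff cycle_graph)%R.
Proof.
have := beta_S_cycle_ge; have := beta_M_cycle_le; rewrite /beta_diff.
set s := beta_S _; set m := beta_M _; lia.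
Qed.

End Cycle.

(** Starting from [G], pass to a graph with larger difference while one exists; the integer gap to
    [B] shrinks each time. Excluded middle decides whether such a graph exists. *)
Lemma max_beta_diff_exists (n : nat) (B : int) (G : cgraph) :
  (forall H : cgraph, #|H| = n -> (beta_diff H <= B)%R) -> #|G| = n ->
  exists2 m, is_max_beta_diff n m & (beta_diff G <= m)%R.
Proof.
move=> ub; have [k] : exists k : nat, (B - beta_diff G <= k%:Z)%R.
  by exists `|B - beta_diff G|%N; lia.
elim: k G => [|k IHk] G gap Gn.
all: have [[H [Hn GH]]|noH] :=
  classic (exists H : cgraph, #|H| = n /\ (beta_diff G < beta_diff H)%R).
(* With gap 0 the graph already attains [B], so none can exceed it. *)
- by have := ub H Hn; lia.
- exists (beta_diff G) => //; split; first by exists G.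
  by move=> H Hn; have := ub H Hn; lia.
- have [|//|m mmax Hm] := IHk H; first lia.
  by exists m => //; lia.
- exists (beta_diff G) => //; split; first by exists G.
  move=> H Hn; rewrite Order.TotalTheory.leNgt; apply/negP => GH.
  by apply: noH; exists H.
Qed.

Theorem theorem2 (n : nat) (hn : 7 <= n) :
  exists m : int, is_max_beta_diff n m /\
    (((n - 1) %/ 2)%N%:Z - 2 <= m /\ m <= n%:Z - 4)%R.
Proof.
have ub (H : cgraph) : #|H| = n -> (beta_diff H <= n%:Z - 4)%R.
  by move=> Hn; rewrite -Hn; apply: beta_diff_le; lia.
have [m mmax lb] := max_beta_diff_exists ub (card_ord n : #|cycle_graph hn| = n).
exists m; split=> //; split.
  by have := beta_diff_cycle_ge hn; lia.
by have [[G [Gn <-]] _] := mmax; exact: ub.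
Qed.
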